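(* Let $G$ be a bounded graph with edge-perturbed twin subgraphs $X_1$ and $X_2$ with bijection $f:V(X_1)\to V(X_2)$ and associated automorphism $\hat f$, and let $\Pi$ be an equitable partition of $G$ in which $\{a,\hat f(a)\}$ is a cell for every $a\in V(X_1)$. Let $D$ be a diagonal matrix with diagonal entries in $\{1,-1\}$, and let $\tilde G_D$ be the graph with $A(\tilde G_D)=DA(G)D$. If $U'(t)=\exp\big(it(A(X_1)-A')\big)$, then $$(DQ)^TU_{\tilde G_D}(t)\,DQ=\begin{bmatrix}U'(t)&\mathbf 0\\ \mathbf 0&U_{G/\Pi}(t)\end{bmatrix}\quad\text{for all }t\in\mathbb R.$$
   Context: A graph has a countable vertex set and a symmetric real weight function $w$ with $w(a,b)\ne0$ iff $\{a,b\}$ is an edge (no loops). It is bounded if $\sum_b|w(a,b)|^2<\infty$ for each $a$ and the absolute degrees $\sum_b|w(a,b)|$ are uniformly bounded; $A(G)_{a,b}=w(a,b)$ and $U_G(t)=\exp(itA(G))$. $\mathbf e_a$ is a standard basis vector. Edge-perturbed twin subgraphs: $G$ connected, $X_1,X_2$ vertex-disjoint induced subgraphs, $f$ a bijection with $w(f(a),f(b))=w(a,b)$ for $a,b\in V(X_1)$, $w(f(a),y)=w(a,y)$ for $a\in V(X_1)$, $y\notin V(X_1)\cup V(X_2)$, and $w(a,f(b))=w(f(a),b)$ for $a,b\in V(X_1)$. $\hat f$ swaps $a$ and $f(a)$ and fixes all other vertices. $A'$ is the matrix indexed by $V(X_1)$ with $(A')_{u,v}=w(u,f(v))$. A partition $\Pi=\bigcup_jV_j$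 into finite cells is equitable if $\sum_{b\in V_k}w(a,b)=c_{jk}$ is independent of $a\in V_j$; $A(G/\Pi)_{j,k}=\operatorname{sign}(c_{jk})\sqrt{c_{jk}c_{kj}}$. $Q=[\mathcal B~~\mathcal C]$, where $\mathcal B$ has columns $\frac1{\sqrt2}(\mathbf e_a-\mathbf e_{\hat f(a)})$, $a\in V(X_1)$, and $\mathcal C$ is the normalized characteristic matrix of $\Pi$ (column $j$ is $|V_j|^{-1/2}$ times the indicator of $V_j$). *)

(* Defs.v *)
From HB Require Import structures.
From mathcomp Require Import all_boot all_order all_algebra.
From mathcomp Require Import finmap complex.
From mathcomp Require Import all_classical all_reals all_analysis.
From mathcomp Require showcase.summability.

Set Implicit Arguments.
Unset Strict Implicit.
Unset Printing Implicit Defensive.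

Import Order.TTheory GRing.Theory Num.Theory numFieldNormedType.Exports.

Local Open Scope classical_set_scope.
Local Open Scope complex_scope.
Local Open Scope ring_scope.

Section InfiniteMatrices.
Context {K : numFieldType}.

Definition imx (I J : Type) := I -> J -> K.

(* [summability.sum] is the unconditional sum: the limit of the finite partial
   sums along the directed set of finite subsets of the index type.  All the
   sums occurring below are absolutely convergent for bounded graphs. *)
Definition isum (I : choiceType) (x : I -> K) : K :=
  summability.sum (fun i => x i : K^o).

Definition imulmx (I L : Type) (J : choiceType)
    (A : imx I J) (B : imx J L) : imx I L :=
  fun i l => isum (fun j => A i j * B j l).

Definition iscalemx (I J : Type) (z : K) (A : imx I J) : imx I J :=
  fun i j => z * A i j.

Definition isubmx (I J : Type) (A B : imx I J) : imx I J :=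
  fun i j => A i j - B i j.

Definition itrmx (I J : Type) (A : imx I J) : imx J I := fun j i => A i j.

Definition iidmx (I : choiceType) : imx I I := fun i j => (i == j)%:R.

Definition ipowmx (I : choiceType) (A : imx I I) (n : nat) : imx I I :=
  iter n (imulmx A) (iidmx (I := I)).

(* For A the matrix of a bounded operator on l^2, the power series of exp A
   converges in operator norm, so its matrix is the entrywise limit. *)
Definition iexpmx (I : choiceType) (A : imx I I) : imx I I :=
  fun i j => limn (series (fun n => (n`!%:R)^-1 * ipowmx A n i j : K^o)).

Definition irow_mx (I J L : Type) (A : imx I J) (B : imx I L) :
    imx I (J + L)%type :=
  fun i s => match s with inl j => A i j | inr l => B i l end.

Definition iblock_diag (I J : Type) (A : imx I I) (B : imx J J) :
    imx (I + J)%type (I + J)%type :=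
  fun s s' => match s, s' with
    | inl i, inl i' => A i i'
    | inr j, inr j' => B j j'
    | _, _ => 0
    end.

Definition sign_diagonal (I : eqType) (D : imx I I) : Prop :=
  (forall i j, i != j -> D i j = 0) /\ (forall i, D i i = 1 \/ D i i = -1).

End InfiniteMatrices.

Arguments imx K I J : clear implicits.

(* Since w(a,b) <> 0 iff {a,b} is an edge, a graph is determined by its weight
   function. *)
Record wgraph (R : realType) (V : countType) := WGraph {
  weight :> V -> V -> R;
  weight_sym : forall a b, weight a b = weight b a;
  weight_loopless : forall a, weight a a = 0
}.

Section Graphs.
Context {R : realType} {V : countType}.
Implicit Types (G : wgraph R V) (X : {pred V}).

Definition adj G (a b : V) := weight G a b != 0.

Definition connected_graph G : Prop :=
  forall a b, exists p : seq V, path (adj G) a p /\ last a p = b.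

Definition bounded_graph G : Prop :=
  (forall a, (\esum_(b in setT) (`|G a b| ^+ 2)%:E < +oo)%E) /\
  (exists M : R, forall a, (\esum_(b in setT) `|G a b|%:E <= M%:E)%E).

Definition adjmx G : imx R[i] V V := fun a b => (G a b)%:C.

Definition induced_subgraph G X : wgraph R {a : V | a \in X} :=
  @WGraph R {a : V | a \in X} (fun a b => G (val a) (val b))
    (fun a b => weight_sym G (val a) (val b))
    (fun a => weight_loopless G (val a)).

End Graphs.

Definition transition {R : realType} {I : choiceType} (A : imx R[i] I I)
    (t : R) : imx R[i] I I :=
  iexpmx (iscalemx ('i * t%:C) A).

Section Twins.
Context {R : realType} {V : countType}.
Variables (G : wgraph R V) (X1 X2 : {pred V}).
Variable f : {a : V | a \in X1} -> {a : V | a \in X2}.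

Record edge_perturbed_twins : Prop := {
  ept_connected : connected_graph G;
  ept_disjoint : forall a, a \in X1 -> a \notin X2;
  ept_bij : bijective f;
  ept_iso : forall a b, G (val (f a)) (val (f b)) = G (val a) (val b);
  ept_outside : forall a y, y \notin X1 -> y \notin X2 ->
    G (val (f a)) y = G (val a) y;
  ept_cross : forall a b, G (val a) (val (f b)) = G (val (f a)) (val b)
}.

(* [xget x P] is an element of P if there is one, and x otherwise; so for x
   outside V(X1) this is the f-preimage of x if x is in V(X2), and x itself if
   it is not. *)
Definition fhat (x : V) : V :=
  match insub x with
  | Some a => val (f a)
  | None => xget x [set val a | a in [set a | val (f a) = x]]
  end.

Definition crossmx : imx R[i] {a : V | a \in X1} {a : V | a \in X1} :=
  fun u v => (G (val u) (val (f v)))%:C.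

Definition twin_diffmx : imx R[i] V {a : V | a \in X1} :=
  fun v a => ((Num.sqrt 2)^-1 *
    ((v == val a)%:R - (v == fhat (val a))%:R))%:C.

End Twins.

Section Equitable.
Context {R : realType} {V : countType} {J : choiceType}.

Record equitable (G : wgraph R V) (cell : J -> set V) (c : J -> J -> R) :
    Prop := {
  equitable_partition : classical_sets.partition setT cell setT;
  equitable_finite : forall j, finite_set (cell j);
  equitable_sum : forall j k a, cell j a -> \sum_(b \in cell k) G a b = c j k
}.

Definition quotientmx (c : J -> J -> R) : imx R[i] J J :=
  fun j k => (Num.sg (c j k) * Num.sqrt (c j k * c k j))%:C.

Definition characteristicmx (cell : J -> set V) : imx R[i] V J :=
  fun v j => ((Num.sqrt #|` fset_set (cell j)|%:R)^-1 * \1_(cell j) v)%:C.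

End Equitable.

(* Main.v *)
(* For a bounded A the powers satisfy |A^n(a,b)| <= m^n, so the entries of the
   powers and of the exponential are absolutely convergent sums.  If A Q = Q B,
   where the columns of Q are finitely supported and each row of Q has at most
   one nonzero entry, then the column supports of Q are disjoint finite cells;
   grouping the sum in A (A^n Q) by these cells gives A^n Q = Q B^n, hence
   exp(A) Q = Q exp(B).  This applies separately to the twin differences
   (B = A(X_1) - A') and to the characteristic matrix (B = A(G/Pi)), whereas the
   concatenation of the two has rows with two nonzero entries.  Then
   P^T exp(A) Q = (P^T Q) exp(B), with P^T Q the identity or zero.  Conjugation
   by D is absorbed by replacing A and Q with D A D and D Q. *)
Require Import Defs.
From HB Require Import structures.
From mathcomp Require Import all_boot all_order all_algebra.
From mathcomp Require Import finmap complex.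
From mathcomp Require Import all_classical all_reals all_analysis.

Set Implicit Arguments.
Unset Strict Implicit.
Unset Printing Implicit Defensive.

Import Order.TTheory GRing.Theory Num.Theory numFieldNormedType.Exports.

Local Open Scope classical_set_scope.
Local Open Scope complex_scope.
Local Open Scope ring_scope.

(* Unconditional sums *)
#[local] Existing Instance summability.totally_filter.

(** [isum] is a [lim], which takes a value even without convergence. This relation records
    convergence as well, so it can be carried through linear combinations and regroupings. *)
Definition sums_to {K : numFieldType} {I : choiceType} (x : I -> K) (l : K) :=
  summability.partial_sum (x : I -> K^o) @ summability.totally --> (l : K^o).

Section Sums.
Context {K : numFieldType}.
Implicit Types I J : choiceType.

Lemma sums_toP {I} (x : I -> K) (l : K) :
  sums_to x l <-> forall e : K, 0 < e ->
    exists A : {fset I}, forall B : {fset I},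
      (A `<=` B)%fset -> `|l - \sum_(i <- B) x i| < e.
Proof.
rewrite /sums_to; split.
  move=> /cvgrPdist_lt xl e e0; have [A _ AP] := xl e e0.
  by exists A => B AB; rewrite big_seq_fsetE; exact: AP.
move=> xl; apply/cvgrPdist_lt => e e0; have [A AP] := xl e e0.
by exists A => // B /= AB; have := AP B AB; rewrite big_seq_fsetE.
Qed.

Lemma sums_to_isum {I} (x : I -> K) (l : K) : sums_to x l -> isum x = l.
Proof. exact: (@cvg_lim K^o (@norm_hausdorff K K^o)). Qed.

Lemma sums_to_finite {I} (x : I -> K) (F : {fset I}) :
  (forall i, i \notin F -> x i = 0) -> sums_to x (\sum_(i <- F) x i).
Proof.
move=> xF; apply/sums_toP => e e0; exists F => B FB.
rewrite (big_fset_incl _ FB) ?subrr ?normr0 // => i _; exact: xF.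
Qed.

Lemma sums_to0 {I} (x : I -> K) : (forall i, x i = 0) -> sums_to x 0.
Proof.
move=> x0; rewrite -(@big_seq_fset0 _ 0 +%R _ x).
by apply: sums_to_finite => i _; exact: x0.
Qed.

Lemma sums_to_single {I} (x : I -> K) (i0 : I) :
  (forall i, i != i0 -> x i = 0) -> sums_to x (x i0).
Proof.
move=> xi0; rewrite -[x i0](big_seq_fset1 +%R i0 x).
by apply: sums_to_finite => i; rewrite inE; exact: xi0.
Qed.

Lemma sums_toD {I} (x y : I -> K) (a b : K) :
  sums_to x a -> sums_to y b -> sums_to (fun i => x i + y i) (a + b).
Proof.
rewrite /sums_to => xa yb; rewrite [X in X @ _ --> _](_ : _ =
  summability.partial_sum (x : I -> K^o) \+ summability.partial_sum (y : I -> K^o)).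
  exact: cvgD.
by apply/funext => B; rewrite /summability.partial_sum /= big_split.
Qed.

Lemma sums_toZ {I} (z : K) (x : I -> K) (a : K) :
  sums_to x a -> sums_to (fun i => z * x i) (z * a).
Proof.
rewrite /sums_to => xa; rewrite [X in X @ _ --> _](_ : _ =
  z \*: summability.partial_sum (x : I -> K^o)).
  exact: cvgZl_tmp.
by apply/funext => B; rewrite /summability.partial_sum /= -mulr_sumr.
Qed.

Lemma sums_to_sum {I J} (r : seq J) (x : J -> I -> K) (a : J -> K) :
  (forall j, j \in r -> sums_to (x j) (a j)) ->
  sums_to (fun i => \sum_(j <- r) x j i) (\sum_(j <- r) a j).
Proof.
elim: r => [|j r IH] xa.
  by rewrite big_nil; apply: sums_to0 => i; rewrite big_nil.
rewrite big_cons; under eq_fun do rewrite big_cons.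
apply: sums_toD; first by apply: xa; rewrite inE eqxx.
by apply: IH => k kr; apply: xa; rewrite inE kr orbT.
Qed.

(** If partial sums over supersets of [A] are close to [l], take any finite set [B] of groups
    containing one for each nonzero term of [A]. The grouped sum over [B] is then the sum over [U],
    the union of [A] and the groups in [B]: the terms of [A] outside these groups vanish. *)
Lemma sums_to_group {I J} (F : J -> {fset I}) (x : I -> K) (l : K) :
  (forall i j k, i \in F j -> i \in F k -> j = k) ->
  (forall i, x i != 0 -> exists j, i \in F j) ->
  sums_to x l -> sums_to (fun j => \sum_(i <- F j) x i) l.
Proof.
move=> Fdisj Fcov /sums_toP xl; apply/sums_toP => e e0.
have [A AP] := xl e e0.
(* [g] picks the group of each nonzero term; [None] serves for zero terms, which may lie in no
   group. *)
have [g gP] : exists g : I -> option J,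
    forall i, x i != 0 -> exists2 j, g i = Some j & i \in F j.
  have /choice[g gP] : forall i, exists o : option J,
      x i != 0 -> exists2 j, o = Some j & i \in F j.
    move=> i; have [xi|/Fcov[j ij]] := eqVneq (x i) 0; first by exists None.
    by exists (Some j) => _; exists j.
  by exists g.
exists [fset j in pmap g A]%fset => B AB.
pose U := (A `|` [fset i in flatten [seq enum_fset (F j) | j <- enum_fset B]])%fset.
suff -> : \sum_(j <- B) \sum_(i <- F j) x i = \sum_(i <- U) x i.
  by apply: AP; exact: fsubsetUl.
have FU j : j \in B -> (F j `<=` U)%fset.
  move=> jB; apply/fsubsetP => i ij; rewrite !inE /=; apply/orP; right.
  by apply/flatten_mapP; exists j.
transitivity (\sum_(j <- B) \sum_(i <- U) if i \in F j then x i else 0).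
  rewrite big_seq_cond [RHS]big_seq_cond; apply: eq_bigr => j /andP[jB _].
  rewrite -(big_fset_incl _ (FU j jB)).
    by rewrite big_seq [RHS]big_seq; apply: eq_bigr => i ->.
  by move=> i _ /negPf ->.
rewrite exchange_big /= big_seq [RHS]big_seq; apply: eq_bigr => i iU.
have [xi|xi] := eqVneq (x i) 0.
  by rewrite xi big1 // => j _; case: ifP.
have [j jB ij] : exists2 j, j \in B & i \in F j.
  move: iU; rewrite !inE => /orP[iA|/flatten_mapP[j jB ij]]; last by exists j.
  have [j gj ij] := gP i xi; exists j => //.
  apply: (fsubsetP AB); rewrite !inE /=.
  by rewrite mem_pmap -gj map_f.
rewrite (big_fsetD1 j) //= ij big_seq big1 ?addr0 // => k.
rewrite !inE => /andP[kj kB]; case: ifP => // ik.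
by rewrite (Fdisj i k j ik ij) eqxx in kj.
Qed.

Lemma sums_to_series (x : nat -> K) (l : K) :
  sums_to x l -> series (x : nat -> K^o) @ \oo --> (l : K^o).
Proof.
move=> /sums_toP xl; apply/cvgrPdist_lt => e e0; have [A AP] := xl e e0.
(* The successor puts all of [A] strictly below [n], since [series] sums the indices below [n]. *)
exists (\max_(i <- A) i.+1)%N => // n /= An.
rewrite /series /= /index_iota subn0.
rewrite -(@perm_big _ _ _ _ [fset i in iota 0 n]%fset); last first.
  by apply: uniq_perm => [||i]; rewrite ?fset_uniq ?iota_uniq // !inE.
apply: AP; apply/fsubsetP => i iA; rewrite !inE /= mem_iota add0n /=.
by apply: leq_trans An; rewrite (big_fsetD1 i) //= leq_maxl.
Qed.

End Sums.

Lemma ler_sum_fsubset {K : numDomainType} {I : choiceType} (x : I -> K)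
  (A B : {fset I}) : (forall i, 0 <= x i) -> (A `<=` B)%fset ->
  \sum_(i <- A) x i <= \sum_(i <- B) x i.
Proof.
move=> x0 AB; rewrite [leRHS](big_fsetID _ (mem A)) /=.
rewrite (_ : [fset i in B | i \in A]%fset = A) ?lerDl ?sumr_ge0 //.
apply/fsetP => i; rewrite !inE /= andbC.
by apply: andb_idr; exact: (fsubsetP AB).
Qed.

Lemma sums_to_norm_le {K : numFieldType} {I : choiceType} (x : I -> K) (l m : K) :
  (forall F : {fset I}, \sum_(i <- F) `|x i| <= m) -> sums_to x l -> `|l| <= m.
Proof.
move=> xm /sums_toP xl; apply/ler_addgt0Pr => e /xl[A] /(_ A (fsubset_refl _)) Ae.
rewrite -(subrK (\sum_(i <- A) x i) l) addrC.
apply: le_trans (ler_normD _ _) _; apply: lerD; last exact: ltW.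
exact: le_trans (ler_norm_sum _ _ _) (xm A).
Qed.

(** * Absolutely bounded families converge *)

Section AbsoluteConvergence.
Context {R : realType}.
Implicit Types I : choiceType.

(** The limit is the supremum of the finite partial sums, which increase with the index set. *)
Lemma sums_to_nonneg {I} (x : I -> R) (m : R) : (forall i, 0 <= x i) ->
  (forall F : {fset I}, \sum_(i <- F) x i <= m) ->
  exists l : R, sums_to (fun i => (x i)%:C) l%:C.
Proof.
move=> x0 xm; pose E := [set \sum_(i <- F) x i | F in [set: {fset I}]].
have Eub : has_ubound E by exists m => _ [F _ <-].
have Esup : has_sup E by split=> //; exists (\sum_(i <- fset0) x i), fset0.
exists (sup E); apply/sums_toP => e e0.
(* In the order of [R[i]], a positive element is real. *)
have eE : e = (complex.Re e)%:C by rewrite RRe_real ?gtr0_real.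
rewrite eE; have {}e0 : 0 < complex.Re e by move: e0; rewrite ltcE => /andP[].
have [_ [A _ <-] Ae] := sup_adherent e0 Esup.
exists A => B AB; rewrite -rmorph_sum -rmorphB /=.
have BE : \sum_(i <- B) x i <= sup E by apply: ub_le_sup => //; exists B.
rewrite ger0_norm ?ler0c ?subr_ge0 // ltcR ltrBlDl -ltrBlDr.
exact: lt_le_trans Ae (ler_sum_fsubset x0 AB).
Qed.

(** [x] is the difference of the nonnegative families [|x| + x] and [|x|], whose partial sums are at
    most [m + m] and [m]. *)
Lemma sums_to_real {I} (x : I -> R) (m : R) :
  (forall F : {fset I}, \sum_(i <- F) `|x i| <= m) ->
  exists l : R, sums_to (fun i => (x i)%:C) l%:C.
Proof.
move=> xm.
have [a abs_a] := sums_to_nonneg (fun i => normr_ge0 (x i)) xm.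
have [||b pos_b] := @sums_to_nonneg I (fun i => `|x i| + x i) (m + m).
- by move=> i; rewrite -lerBlDr sub0r -normrN ler_norm.
- move=> F; rewrite big_split /=; apply: lerD => //.
  by apply: le_trans (xm F); apply: ler_sum => i _; exact: ler_norm.
exists (b - a); have := sums_toD pos_b (sums_toZ (z := -1) abs_a).
rewrite mulN1r -rmorphB; congr sums_to; apply/funext => i /=.
by rewrite mulN1r -rmorphB /= addrC addKr.
Qed.

Lemma abs_summable_sums_to {I} (x : I -> R[i]) (m : R) :
  (forall F : {fset I}, \sum_(i <- F) `|x i| <= m%:C) -> exists l, sums_to x l.
Proof.
move=> xm.
have [|a re_a] := @sums_to_real I (fun i => complex.Re (x i)) m.
  move=> F; rewrite -lecR (le_trans _ (xm F)) // rmorph_sum /=.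
  by apply: ler_sum => i _; exact: normc_ge_Re.
have [|b im_b] := @sums_to_real I (fun i => complex.Im (x i)) m.
  move=> F; rewrite -lecR (le_trans _ (xm F)) // rmorph_sum /=.
  (* The imaginary part of [x i] is, up to sign, the real part of [x i * 'i]. *)
  apply: ler_sum => i _; have := normc_ge_Re (x i * 'i%C).
  by rewrite ReiNIm normrN normrM (normc_def 'i%C) /= expr0n expr1n add0r sqrtr1 mulr1.
exists (a%:C + 'i%C * b%:C); have := sums_toD re_a (sums_toZ (z := 'i%C) im_b).
by congr sums_to; apply/funext => i; rewrite -complexE.
Qed.

(** The terms are dominated by those of the exponential series of [m], so [expR m] bounds every
    finite sum of absolute values. *)
Lemma exp_sums_to (x : nat -> R[i]) (m : R) :
  (forall n, `|x n| <= (m ^+ n)%:C) ->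
  exists l, sums_to (fun n => n`!%:R^-1 * x n) l.
Proof.
move=> xm; have m0 : 0 <= m.
  by have := le_trans (normr_ge0 _) (xm 1%N); rewrite expr1 ler0c.
apply: (@abs_summable_sums_to _ _ (expR m)) => F.
apply: (@le_trans _ _ (\sum_(n <- F) exp_coeff m n)%:C).
  rewrite rmorph_sum /=; apply: ler_sum => n _.
  rewrite normrM normfV normr_nat /exp_coeff /= mulrC.
  by rewrite [_%:C]rmorphM fmorphV rmorph_nat ler_wpM2r.
rewrite lecR; pose N := (\max_(i <- F) i.+1)%N.
apply: (@le_trans _ _ (series (exp_coeff m) N)).
  rewrite -lee_fin -sumEFin /series /= -sumEFin.
  apply: lee_sum_fset_nat => [n _|n /= nF]; first by rewrite lee_fin exp_coeff_ge0.
  by rewrite /N (big_fsetD1 n) //= leq_maxl.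
apply: nondecreasing_cvgn_le; last exact: is_cvg_series_exp_coeff.
by apply: nondecreasing_series => n _ _; exact: exp_coeff_ge0.
Qed.

End AbsoluteConvergence.

(** * Matrices with finite columns and at most one nonzero entry per row *)

Definition col_finite {K : numFieldType} {I J : choiceType} (Q : imx K I J) :=
  forall j, finite_set [set i | Q i j != 0].

Definition row_sparse {K : numFieldType} {I J : choiceType} (Q : imx K I J) :=
  forall i j k, j != k -> Q i j = 0 \/ Q i k = 0.

Definition col_supp {K : numFieldType} {I J : choiceType} (Q : imx K I J) (j : J) :
  {fset I} := fset_set [set i | Q i j != 0].

Section SparseMatrices.
Context {K : numFieldType}.
Implicit Types I J L : choiceType.

Lemma in_col_supp {I J} (Q : imx K I J) : col_finite Q ->
  forall i j, (i \in col_supp Q j) = (Q i j != 0).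
Proof.
move=> Qfin i j; rewrite in_fset_set //.
by apply/idP/idP; rewrite inE.
Qed.

Lemma imulmx_col_finite {L I J} (E : imx K L I) (Q : imx K I J) : col_finite Q ->
  forall l j, imulmx E Q l j = \sum_(i <- col_supp Q j) E l i * Q i j.
Proof.
move=> Qfin l j; apply/sums_to_isum/sums_to_finite => i.
by rewrite in_col_supp // negbK => /eqP ->; rewrite mulr0.
Qed.

Lemma imulmx_itr_col_finite {L I J} (P : imx K I J) (E : imx K I L) : col_finite P ->
  forall j l, imulmx (itrmx P) E j l = \sum_(i <- col_supp P j) P i j * E i l.
Proof.
move=> Pfin j l; apply/sums_to_isum/sums_to_finite => i.
by rewrite in_col_supp // negbK => /eqP Pij; rewrite /itrmx Pij mul0r.
Qed.

(** The pivot is the position of the only possible nonzero entry of the row; [j0] makes a pivot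
    available in a zero row. *)
Lemma row_sparse_pivot {I J} (Q : imx K I J) (j0 : J) : row_sparse Q ->
  forall i, exists j, forall k, k != j -> Q i k = 0.
Proof.
move=> Qsp i; have [[j Qij]|Qi0] := pselect (exists j, Q i j != 0).
  by exists j => k /(Qsp i k j)[//|Qij0]; rewrite Qij0 eqxx in Qij.
exists j0 => k _; apply: contrapT => Qik; apply: Qi0.
by exists k; exact/eqP.
Qed.

Lemma pivot_sums_to {I J L} (Q : imx K I J) (E : imx K J L) i j l :
  (forall k, k != j -> Q i k = 0) -> sums_to (fun k => Q i k * E k l) (Q i j * E j l).
Proof.
by move=> Qi0; apply: sums_to_single => k /Qi0 ->; rewrite mul0r.
Qed.

Lemma pivot_imulmx {I J L} (Q : imx K I J) (E : imx K J L) i j l :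
  (forall k, k != j -> Q i k = 0) -> imulmx Q E i l = Q i j * E j l.
Proof. by move=> Qi0; exact/sums_to_isum/pivot_sums_to. Qed.

Lemma imulmx_id_l {I J} (E : imx K I J) : imulmx (iidmx (I := I)) E = E.
Proof.
apply/funext => i; apply/funext => j.
rewrite (@pivot_imulmx _ _ _ _ _ i i) /iidmx ?eqxx ?mul1r // => k.
by rewrite eq_sym => /negPf ->.
Qed.

Lemma imulmx_id_r {I J} (E : imx K I J) : imulmx E (iidmx (I := J)) = E.
Proof.
apply/funext => i; apply/funext => j.
have /sums_to_isum : sums_to (fun k => E i k * iidmx k j) (E i j * iidmx j j).
  apply: (@sums_to_single _ _ (fun k => E i k * iidmx k j)) => k.
  by rewrite /iidmx => /negPf ->; rewrite mulr0.
by rewrite [X in _ * X]/iidmx eqxx mulr1.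
Qed.

Lemma imulmx_0_l {I J L} (E : imx K J L) : imulmx (fun (_ : I) _ => 0) E = fun _ _ => 0.
Proof.
apply/funext => i; apply/funext => l; apply/sums_to_isum/sums_to0 => j.
by rewrite mul0r.
Qed.

(** Finite column supports on both sides turn every sum into a finite one, so associativity is a
    finite exchange. *)
Lemma imulmx_sandwich {I J L} (P : imx K I J) (E : imx K I I) (Q : imx K I L) :
  col_finite P -> col_finite Q ->
  imulmx (imulmx (itrmx P) E) Q = imulmx (itrmx P) (imulmx E Q).
Proof.
move=> Pfin Qfin; apply/funext => j; apply/funext => l.
rewrite imulmx_col_finite // imulmx_itr_col_finite //.
under eq_bigr do rewrite imulmx_itr_col_finite // mulr_suml.
under [RHS]eq_bigr do rewrite imulmx_col_finite // mulr_sumr.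
rewrite exchange_big /=; apply: eq_bigr => i _; apply: eq_bigr => k _.
by rewrite mulrA.
Qed.

(** The sum over the rows of [Q] is finite and each row of [Q] times [E] has at most one nonzero
    term, so the sum over [L] is a finite combination of convergent sums. *)
Lemma imulmx_itrA {I J L} (M : choiceType)
    (P : imx K I J) (Q : imx K I L) (E : imx K L M) :
  col_finite P -> row_sparse Q ->
  imulmx (itrmx P) (imulmx Q E) = imulmx (imulmx (itrmx P) Q) E.
Proof.
move=> Pfin Qsp; apply/funext => j; apply/funext => l.
rewrite imulmx_itr_col_finite //; apply/esym/sums_to_isum.
have QE i : sums_to (fun k => Q i k * E k l) (imulmx Q E i l).
  (* A zero row supplies no index of [L] to start [row_sparse_pivot] from, so it is treated
     apart. *)
  have [[k Qik]|Qi0] := pselect (exists k, Q i k != 0).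
    have [k0 Qik0] := row_sparse_pivot k Qsp i.
    by rewrite (pivot_imulmx _ _ Qik0); exact: pivot_sums_to.
  have {}Qi0 k : Q i k * E k l = 0.
    rewrite (_ : Q i k = 0) ?mul0r //; apply: contrapT => /eqP Qik.
    by apply: Qi0; exists k.
  by have QE0 := sums_to0 Qi0; rewrite /imulmx (sums_to_isum QE0).
have := sums_to_sum (fun i _ => sums_toZ (z := P i j) (QE i)).
move=> /(_ (col_supp P j)); congr sums_to; apply/funext => k.
by rewrite imulmx_itr_col_finite // mulr_suml; apply: eq_bigr => i _; rewrite mulrA.
Qed.

Lemma sums_to_iexpmx {I} (A : imx K I I) i j (l : K) :
  sums_to (fun n => n`!%:R^-1 * ipowmx A n i j) l -> iexpmx A i j = l.
Proof.
move=> /sums_to_series; exact: (@cvg_lim K^o (@norm_hausdorff K K^o)).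
Qed.

End SparseMatrices.

(** * Powers and exponentials of intertwined matrices *)

Definition row_bounded {R : realType} {V : choiceType} (A : imx R[i] V V) (m : R) :=
  forall a (F : {fset V}), \sum_(b <- F) `|A a b| <= m%:C.

Section Intertwining.
Context {R : realType} {V S : choiceType}.
Variables (A : imx R[i] V V) (B : imx R[i] S S) (Q : imx R[i] V S) (m : R).
Hypothesis A_bounded : row_bounded A m.

(** Absolute row sums at most [m] make [A] act on bounded sequences with norm at most [m]. Applied
    to the columns of the powers of [A], this yields their bound by induction. *)
Lemma row_bounded_sums_to (x : V -> R[i]) (k : R) (a : V) :
  (forall c, `|x c| <= k%:C) ->
  sums_to (fun c => A a c * x c) (isum (fun c => A a c * x c)) /\
  `|isum (fun c => A a c * x c)| <= (m * k)%:C.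
Proof.
move=> xk; have Ax (F : {fset V}) : \sum_(c <- F) `|A a c * x c| <= (m * k)%:C.
  apply: (@le_trans _ _ (\sum_(c <- F) `|A a c| * k%:C)).
    by apply: ler_sum => c _; rewrite normrM ler_wpM2l.
  rewrite -mulr_suml rmorphM ler_wpM2r //; exact: le_trans (xk a).
have [l Axl] := abs_summable_sums_to Ax.
by rewrite (sums_to_isum Axl); split => //; exact: sums_to_norm_le Ax Axl.
Qed.

Lemma ipowmx_bound n a b : `|ipowmx A n a b| <= (m ^+ n)%:C.
Proof.
elim: n a b => [|n IH] a b.
  by rewrite /= /iidmx; case: eqP; rewrite ?normr0 ?normr1.
rewrite exprS.
by have [] := @row_bounded_sums_to (fun c => ipowmx A n c b) _ a (fun c => IH c b).
Qed.

Lemma iexpmx_sums_to a b :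
  sums_to (fun n => n`!%:R^-1 * ipowmx A n a b) (iexpmx A a b).
Proof.
have [l Al] := exp_sums_to (fun n => ipowmx_bound n a b).
by rewrite (sums_to_iexpmx Al).
Qed.

Hypothesis Qfin : col_finite Q.
Hypothesis Qsp : row_sparse Q.
Hypothesis AQ : imulmx A Q = imulmx Q B.

(** By induction [A^n Q = Q B^n]; grouping the sum in [A (Q B^n)] by the column supports of [Q]
    gives [(A Q) B^n = Q B B^n]. Convergence of the sums in [B B^n] is inherited from the [A] side
    by dividing by the pivot entry of [Q]. *)
Lemma ipowmx_intertwine n : imulmx (ipowmx A n) Q = imulmx Q (ipowmx B n).
Proof.
elim: n => [|n IH]; first by rewrite /= imulmx_id_l imulmx_id_r.
apply/funext => a; apply/funext => s0.
pose x c := imulmx (ipowmx A n) Q c s0.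
(* [A^(n+1) Q = A (A^n Q)] with convergence: column [s0] of [Q] is finite, so this is a finite
   combination of the convergent sums in [A A^n]. *)
have ax : sums_to (fun c => A a c * x c) (imulmx (ipowmx A n.+1) Q a s0).
  rewrite imulmx_col_finite //.
  have := @sums_to_sum R[i] V V (col_supp Q s0)
    (fun v c => Q v s0 * (A a c * ipowmx A n c v))
    (fun v => Q v s0 * ipowmx A n.+1 a v).
  under [X in _ -> sums_to _ X]eq_bigr do rewrite mulrC.
  move=> H; have {}H := H (fun v _ => sums_toZ
    (row_bounded_sums_to a (fun c => ipowmx_bound n c v)).1).
  move: H; congr sums_to; apply/funext => c; rewrite /x imulmx_col_finite // mulr_sumr.
  by apply: eq_bigr => v _; rewrite mulrC mulrA.
have [s1 Qa] := row_sparse_pivot s0 Qsp a; rewrite (pivot_imulmx _ _ Qa).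
have Qx c s : Q c s != 0 -> x c = Q c s * ipowmx B n s s0.
  move=> Qcs; rewrite /x IH (@pivot_imulmx _ _ _ _ _ _ _ s) // => k ks.
  by case: (Qsp c ks) => // Qcs0; rewrite Qcs0 eqxx in Qcs.
have cells c s s' : c \in col_supp Q s -> c \in col_supp Q s' -> s = s'.
  rewrite !in_col_supp // => Qcs Qcs'; apply/eqP/negPn/negP => /(Qsp c)[] Q0.
    by rewrite Q0 eqxx in Qcs.
  by rewrite Q0 eqxx in Qcs'.
have cover c : A a c * x c != 0 -> exists s, c \in col_supp Q s.
  move=> Axc; have [s Qc] := row_sparse_pivot s0 Qsp c; exists s.
  rewrite in_col_supp //; apply: contra_neq Axc => Qcs.
  by rewrite /x IH (pivot_imulmx _ _ Qc) Qcs mul0r mulr0.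
have := sums_to_group cells cover ax.
(* On the support of column [s], [x c] is [Q c s] times a constant, so each group collapses to an
   entry of [A Q = Q B] times that constant; row [a] of [Q B] reduces to its pivot term. *)
have -> : (fun s => \sum_(c <- col_supp Q s) A a c * x c) =
    (fun s => Q a s1 * (B s1 s * ipowmx B n s s0)).
  apply/funext => s.
  rewrite mulrA -(pivot_imulmx _ _ Qa) -AQ imulmx_col_finite // mulr_suml.
  rewrite big_seq [RHS]big_seq; apply: eq_bigr => c.
  by rewrite in_col_supp // => /Qx ->; rewrite mulrA.
(* If the pivot entry vanishes, both sides are zero; otherwise it can be cancelled. *)
have [->|Qas1] := eqVneq (Q a s1) 0 => AQas0.
  rewrite mul0r -(sums_to_isum AQas0); apply/sums_to_isum/sums_to0 => s.
  by rewrite mul0r.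
have := sums_toZ (z := (Q a s1)^-1) AQas0; under eq_fun do rewrite mulKf //.
by move=> /sums_to_isum BB; rewrite /= /imulmx -/(imulmx _ _) BB mulVKf.
Qed.

(** Entry by entry, [exp(A) Q] is a finite combination of exponential series of [A]. By
    [ipowmx_intertwine] its terms are the pivot entry times those of the series of [B]; cancelling a
    nonzero pivot also shows that the latter converges. *)
Lemma iexpmx_intertwine : imulmx (iexpmx A) Q = imulmx Q (iexpmx B).
Proof.
apply/funext => a; apply/funext => s0.
have [s1 Qa] := row_sparse_pivot s0 Qsp a; rewrite (pivot_imulmx _ _ Qa).
have : sums_to (fun n => Q a s1 * (n`!%:R^-1 * ipowmx B n s1 s0))
    (imulmx (iexpmx A) Q a s0).
  rewrite imulmx_col_finite //.
  have := @sums_to_sum R[i] nat V (col_supp Q s0)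
    (fun v n => Q v s0 * (n`!%:R^-1 * ipowmx A n a v)) (fun v => Q v s0 * iexpmx A a v).
  under [X in _ -> sums_to _ X]eq_bigr do rewrite mulrC.
  move=> H; have {}H := H (fun v _ => sums_toZ (@iexpmx_sums_to a v)).
  move: H; congr sums_to; apply/funext => n.
  rewrite mulrCA -(pivot_imulmx _ _ Qa) -ipowmx_intertwine.
  rewrite imulmx_col_finite // mulr_sumr.
  by apply: eq_bigr => v _; rewrite mulrC mulrA.
have [->|Qas1] := eqVneq (Q a s1) 0 => AQas0.
  rewrite mul0r -(sums_to_isum AQas0); apply/sums_to_isum/sums_to0 => n.
  by rewrite mul0r.
have := sums_toZ (z := (Q a s1)^-1) AQas0; under eq_fun do rewrite mulKf //.
by move=> /sums_to_iexpmx ->; rewrite mulVKf.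
Qed.

Lemma iexpmx_compression (T : choiceType) (P : imx R[i] V T) : col_finite P ->
  imulmx (imulmx (itrmx P) (iexpmx A)) Q = imulmx (imulmx (itrmx P) Q) (iexpmx B).
Proof.
by move=> Pfin; rewrite imulmx_sandwich // iexpmx_intertwine imulmx_itrA.
Qed.

End Intertwining.

(** * Conjugation by a diagonal sign matrix *)

Section SignConjugation.
Context {R : realType} {V : choiceType}.
Variables (D : imx R[i] V V).
Hypothesis D_sign : sign_diagonal D.

Lemma sign_diagonal_mul_self v : D v v * D v v = 1.
Proof. by case: (D_sign.2 v) => ->; rewrite ?mulrNN mulr1. Qed.

Lemma sign_diagonal_norm v : `|D v v| = 1.
Proof. by case: (D_sign.2 v) => ->; rewrite ?normrN normr1. Qed.

Lemma sign_diagonal_mul_l (L : choiceType) (E : imx R[i] V L) v l :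
  imulmx D E v l = D v v * E v l.
Proof. by apply: pivot_imulmx => k kv; apply: D_sign.1; rewrite eq_sym. Qed.

Lemma sign_diagonal_mul_r (L : choiceType) (E : imx R[i] L V) l v :
  imulmx E D l v = E l v * D v v.
Proof.
apply/sums_to_isum/(@sums_to_single _ _ (fun k => E l k * D k v)) => k kv.
by rewrite (D_sign.1 _ _ kv) mulr0.
Qed.

Lemma sign_diagonal_col_finite (L : choiceType) (Q : imx R[i] V L) :
  col_finite Q -> col_finite (imulmx D Q).
Proof.
move=> Qfin l; apply: sub_finite_set (Qfin l) => v /=.
by rewrite sign_diagonal_mul_l; apply: contra_neq => ->; rewrite mulr0.
Qed.

Lemma sign_diagonal_row_sparse (L : choiceType) (Q : imx R[i] V L) :
  row_sparse Q -> row_sparse (imulmx D Q).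
Proof.
move=> Qsp v j k /(Qsp v)[] Q0; [left|right];
by rewrite sign_diagonal_mul_l Q0 mulr0.
Qed.

Lemma sign_diagonal_gram (T S : choiceType) (P : imx R[i] V T) (Q : imx R[i] V S) :
  imulmx (itrmx (imulmx D P)) (imulmx D Q) = imulmx (itrmx P) Q.
Proof.
apply/funext => t; apply/funext => s; apply: (congr1 (@isum _ V)).
apply/funext => v; rewrite /itrmx !sign_diagonal_mul_l.
by rewrite mulrACA sign_diagonal_mul_self mul1r.
Qed.

Lemma transition_compression (S T : choiceType) (A A' : imx R[i] V V)
    (B : imx R[i] S S) (P : imx R[i] V T) (Q : imx R[i] V S) (m t : R) :
  row_bounded A m -> A' = imulmx (imulmx D A) D ->
  col_finite P -> col_finite Q -> row_sparse Q ->
  imulmx A Q = imulmx Q B ->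
  imulmx (imulmx (itrmx (imulmx D P)) (transition A' t)) (imulmx D Q) =
  imulmx (imulmx (itrmx P) Q) (transition B t).
Proof.
move=> A_bounded A'E Pfin Qfin Qsp AQ; rewrite -(sign_diagonal_gram P Q) /transition.
have {}A'E a b : A' a b = D a a * A a b * D b b.
  by rewrite A'E sign_diagonal_mul_r sign_diagonal_mul_l.
have DQfin := sign_diagonal_col_finite Qfin.
have DQsp := sign_diagonal_row_sparse Qsp.
(* Signs preserve absolute values, so the row sums only gain the factor [|it|], written as a real
   part because the bound lives in [R]. *)
have A'_bounded : row_bounded (iscalemx ('i * t%:C) A') (complex.Re `|'i * t%:C| * m).
  move=> a F; rewrite [X in _ <= X]rmorphM [X in _ <= X * _](RRe_real (normr_real _)).
  under eq_bigr do rewrite /iscalemx normrM.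
  rewrite -mulr_sumr ler_wpM2l //; apply: le_trans (A_bounded a F).
  apply: ler_sum => b _.
  by rewrite A'E 2!normrM !sign_diagonal_norm mul1r mulr1.
(* [(D A D)(D Q) = D A Q = D Q B] because [D D = 1]; this is checked at the pivot of each row. *)
have A'DQ : imulmx (iscalemx ('i * t%:C) A') (imulmx D Q) =
    imulmx (imulmx D Q) (iscalemx ('i * t%:C) B).
  apply/funext => a; apply/funext => s.
  have [s1 Qa] := row_sparse_pivot s Qsp a.
  have DQa k : k != s1 -> imulmx D Q a k = 0.
    by move=> /Qa Qak; rewrite sign_diagonal_mul_l Qak mulr0.
  rewrite (pivot_imulmx _ _ DQa) sign_diagonal_mul_l /iscalemx.
  rewrite mulrCA -[D a a * _ * _]mulrA -(pivot_imulmx _ _ Qa) -AQ.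
  rewrite mulrA; apply: sums_to_isum.
  have AQs : sums_to (fun v => A a v * Q v s) (imulmx A Q a s).
    rewrite imulmx_col_finite //; apply: sums_to_finite => v.
    by rewrite in_col_supp // negbK => /eqP ->; rewrite mulr0.
  have := sums_toZ (z := 'i * t%:C * D a a) AQs.
  congr sums_to; apply/funext => v.
  rewrite A'E sign_diagonal_mul_l !mulrA; congr (_ * _).
  by rewrite -!mulrA sign_diagonal_mul_self mulr1.
exact: (iexpmx_compression A'_bounded DQfin DQsp A'DQ (sign_diagonal_col_finite Pfin)).
Qed.

End SignConjugation.

(** * The twin-difference columns and [A(X_1) - A'] *)

Section TwinDifferences.
Context {R : realType} {V : countType} (G : wgraph R V) (X1 X2 : {pred V}).
Variable f : {a : V | a \in X1} -> {a : V | a \in X2}.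
Hypothesis twins : edge_perturbed_twins G f.

Implicit Types a b : {a : V | a \in X1}.

Local Notation k := ((Num.sqrt 2)^-1%:C : R[i]).
Local Notation Q := (twin_diffmx f : imx R[i] V {a : V | a \in X1}).

Lemma fhat_val a : fhat f (val a) = val (f a).
Proof. by rewrite /fhat valK. Qed.

Lemma twin_diffmxE v a :
  Q v a = k * ((v == val a)%:R - (v == val (f a))%:R).
Proof. by rewrite /twin_diffmx fhat_val rmorphM rmorphB !rmorph_nat. Qed.

Lemma twin_neq a b : val a == val (f b) = false.
Proof.
apply/negP => /eqP ab; have := ept_disjoint twins (valP a).
by rewrite ab (valP (f b)).
Qed.

Lemma twin_eq a b : (val (f a) == val (f b)) = (a == b).
Proof. by rewrite (inj_eq val_inj) (inj_eq (bij_inj (ept_bij twins))). Qed.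

Lemma twin_diffmx_l a b : Q (val a) b = k * (a == b)%:R.
Proof. by rewrite twin_diffmxE twin_neq subr0. Qed.

Lemma twin_diffmx_r a b : Q (val (f a)) b = - (k * (a == b)%:R).
Proof. by rewrite twin_diffmxE twin_eq eq_sym twin_neq sub0r mulrN. Qed.

Lemma twin_diffmx_out v a : v \notin X1 -> v \notin X2 -> Q v a = 0.
Proof.
move=> v1 v2; rewrite twin_diffmxE.
case: eqP => [va|_]; first by rewrite va (valP a) in v1.
case: eqP => [va|_]; first by rewrite va (valP (f a)) in v2.
by rewrite subrr mulr0.
Qed.

(** Vertices of [X2] are presented through [f], so that both vertices of a twin pair are indexed by
    the same [a]. *)
Variant twin_spec (v : V) : Prop :=
| TwinL (a : {a : V | a \in X1}) of v = val a
| TwinR (a : {a : V | a \in X1}) of v = val (f a)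
| TwinOut of v \notin X1 & v \notin X2.

Lemma twinP v : twin_spec v.
Proof.
have [v1|v1] := boolP (v \in X1); first exact: (@TwinL _ (exist _ v v1)).
have [v2|v2] := boolP (v \in X2); last exact: TwinOut.
have [g _ fg] := ept_bij twins.
by apply: (@TwinR _ (g (exist _ v v2))); rewrite fg.
Qed.

Lemma twin_diffmx_col_finite : col_finite Q.
Proof.
move=> a; apply: (@sub_finite_set _ _ [set val a; val (f a)]) => [v /=|].
  rewrite twin_diffmxE; case: (v =P val a) => [->|_]; first by left.
  case: (v =P val (f a)) => [->|_]; first by right.
  by rewrite subrr mulr0 eqxx.
exact: finite_set2.
Qed.

(** Distinct twin pairs are disjoint. *)
Lemma twin_diffmx_row_sparse : row_sparse Q.
Proof.
move=> v a b ab; case: (twinP v) => [u ->|u ->|v1 v2];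
  last by left; exact: twin_diffmx_out.
  rewrite !twin_diffmx_l; have [->|_] := eqVneq u a; last by left; rewrite mulr0.
  by right; rewrite (negPf ab) mulr0.
rewrite !twin_diffmx_r; have [->|_] := eqVneq u a; last by left; rewrite mulr0 oppr0.
by right; rewrite (negPf ab) mulr0 oppr0.
Qed.

Lemma imulmx_twin_diffmx (L : choiceType) (E : imx R[i] L V) l a :
  imulmx E Q l a = k * (E l (val a) - E l (val (f a))).
Proof.
apply: sums_to_isum.
have single v0 : sums_to (fun v => E l v * (v == v0)%:R) (E l v0).
  have := @sums_to_single _ _ (fun v => E l v * (v == v0)%:R) v0.
  rewrite eqxx mulr1; apply => v /negPf ->.
  by rewrite mulr0.
have := sums_toZ (z := k)
  (sums_toD (single (val a)) (sums_toZ (z := -1) (single (val (f a))))).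
rewrite mulN1r; congr sums_to; apply/funext => v.
by rewrite twin_diffmxE mulN1r -mulrBr mulrCA.
Qed.

Lemma imulmx_itr_twin_diffmx (L : choiceType) (E : imx R[i] V L) a l :
  imulmx (itrmx Q) E a l = k * (E (val a) l - E (val (f a)) l).
Proof.
rewrite -(imulmx_twin_diffmx (itrmx E)) /imulmx; congr isum.
by apply/funext => v; rewrite mulrC.
Qed.

Lemma twin_diffmx_gram : imulmx (itrmx Q) Q = iidmx (I := {a : V | a \in X1}).
Proof.
apply/funext => a; apply/funext => b.
rewrite imulmx_itr_twin_diffmx twin_diffmx_l twin_diffmx_r opprK -mulrDl mulrA.
have -> : k * (k + k) = 1 :> R[i].
  rewrite -rmorphD -rmorphM mulrDr -expr2 exprVn sqr_sqrtr //.
  by rewrite -(rmorph1 (real_complex R)) [in RHS](splitr 1) mul1r.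
by rewrite mul1r.
Qed.

(** Rows in [X1] agree by definition. Rows in [X2] are their negatives, by [ept_iso] and
    [ept_cross]. Elsewhere both sides vanish, since an outside vertex has equal weights to both
    twins. *)
Lemma twin_diffmx_intertwine : imulmx (adjmx G) Q =
  imulmx Q (isubmx (adjmx (induced_subgraph G X1)) (crossmx G f)).
Proof.
apply/funext => v; apply/funext => b; rewrite imulmx_twin_diffmx.
case: (twinP v) => [a ->|a ->|v1 v2].
- rewrite (@pivot_imulmx _ _ _ _ _ _ _ a); last first.
    by move=> c; rewrite twin_diffmx_l eq_sym => /negPf ->; rewrite mulr0.
  by rewrite twin_diffmx_l eqxx mulr1.
- rewrite (@pivot_imulmx _ _ _ _ _ _ _ a); last first.
    by move=> c; rewrite twin_diffmx_r eq_sym => /negPf ->; rewrite mulr0 oppr0.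
  rewrite twin_diffmx_r eqxx mulr1 mulNr -mulrN opprB /isubmx /adjmx /crossmx /=.
  by rewrite (ept_iso twins) (ept_cross twins).
- rewrite (@pivot_imulmx _ _ _ _ _ _ _ b); last by move=> c _; exact: twin_diffmx_out.
  rewrite twin_diffmx_out // mul0r /adjmx ![G v _]weight_sym (ept_outside twins) //.
  by rewrite subrr mulr0.
Qed.

End TwinDifferences.

(** * The characteristic matrix and the quotient matrix *)

Section Characteristic.
Context {R : realType} {V : countType} {J : choiceType}.
Variables (G : wgraph R V) (cell : J -> set V) (c : J -> J -> R).
Hypothesis eqG : equitable G cell c.

Local Notation card j := (#|` fset_set (cell j)|%:R : R).
Local Notation C := (characteristicmx cell : imx R[i] V J).

Lemma cell_cover v : exists j, cell j v.
Proof.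
have [covV _ _] := equitable_partition eqG.
have : cover setT cell v by rewrite covV.
by case=> j _; exists j.
Qed.

Lemma cell_inj v i j : cell i v -> cell j v -> i = j.
Proof.
move=> iv jv; have [_ triv _] := equitable_partition eqG.
by apply: triv => //; exists v.
Qed.

Lemma in_cell v j : (v \in fset_set (cell j)) = (v \in cell j).
Proof. by rewrite in_fset_set //; exact: equitable_finite eqG j. Qed.

Lemma card_cell_gt0 j : 0 < card j.
Proof.
have [_ _ /(_ j I)[v jv]] := equitable_partition eqG.
rewrite ltr0n cardfs_gt0; apply/fset0Pn; exists v.
by rewrite in_cell inE.
Qed.

Lemma characteristicmxE v j : C v j = (Num.sqrt (card j))^-1%:C * (v \in cell j)%:R.
Proof. by rewrite /characteristicmx indicE rmorphM rmorph_nat. Qed.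

Lemma characteristicmx_pivot v i j : cell i v -> j != i -> C v j = 0.
Proof.
move=> iv ji; rewrite characteristicmxE memNset ?mulr0 // => jv.
by rewrite (cell_inj jv iv) eqxx in ji.
Qed.

Lemma characteristicmx_col_finite : col_finite C.
Proof.
move=> j; apply: sub_finite_set (equitable_finite eqG j) => v /=.
rewrite characteristicmxE; case: (boolP (v \in cell j)) => [|_]; first by rewrite inE.
by rewrite mulr0 eqxx.
Qed.

Lemma characteristicmx_row_sparse : row_sparse C.
Proof.
move=> v i j ij; have [l lv] := cell_cover v.
have [il|il] := eqVneq i l; last by left; exact: characteristicmx_pivot lv il.
by right; apply: characteristicmx_pivot lv _; rewrite -il eq_sym.
Qed.

Lemma imulmx_characteristicmx (L : choiceType) (E : imx R[i] L V) l j :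
  imulmx E C l j = (Num.sqrt (card j))^-1%:C * \sum_(v <- fset_set (cell j)) E l v.
Proof.
rewrite mulr_sumr big_seq (eq_bigr (fun v => E l v * C v j)); last first.
  by move=> v; rewrite in_cell => vj; rewrite characteristicmxE vj mulr1 mulrC.
rewrite -big_seq; apply/sums_to_isum/sums_to_finite => v.
by rewrite in_cell characteristicmxE => /negPf ->; rewrite !mulr0.
Qed.

(** Cells are disjoint, and column [j] has [|V_j|] nonzero entries, each of square [1/|V_j|]. *)
Lemma characteristicmx_gram : imulmx (itrmx C) C = iidmx (I := J).
Proof.
apply/funext => i; apply/funext => j; rewrite imulmx_characteristicmx /itrmx.
rewrite big_seq; under eq_bigr => v.
  rewrite in_cell inE => jv.
  rewrite characteristicmxE (_ : (v \in cell i) = (i == j)); last first.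
    by apply/idP/eqP => [|->]; rewrite inE // => iv; exact: cell_inj iv jv.
  over.
rewrite -big_seq /iidmx; have [->|_] := eqVneq i j; last first.
  by rewrite big1 ?mulr0 // => v _; rewrite mulr0.
rewrite big_const_seq count_predT iter_addr_0 mulr1 -[X in _ * X]mulr_natl mulrCA.
rewrite -rmorphM -invfM -expr2 sqr_sqrtr ?ler0n // fmorphV rmorph_nat mulfV //.
by have := card_cell_gt0 j; rewrite ltr0n pnatr_eq0 -lt0n.
Qed.

(** Double counting: both sides are the total weight between the two cells, by symmetry of the
    weights. *)
Lemma equitable_balance i j : card i * c i j = card j * c j i.
Proof.
have rowE k l v : v \in fset_set (cell k) ->
    \sum_(w <- fset_set (cell l)) G v w = c k l.
  rewrite in_cell inE => kv; rewrite -(equitable_sum eqG l kv).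
  by rewrite fsbig_finite //; exact: equitable_finite eqG l.
have total k l : \sum_(v <- fset_set (cell k)) \sum_(w <- fset_set (cell l)) G v w =
    card k * c k l.
  rewrite big_seq (eq_bigr (fun=> c k l)); last by move=> v; exact: rowE.
  by rewrite -big_seq big_const_seq count_predT iter_addr_0 mulr_natl.
rewrite -!total exchange_big /=; apply: eq_bigr => v _; apply: eq_bigr => w _.
exact: weight_sym.
Qed.

(** By [equitable_balance] the product under the root is [c_ij^2 |V_i|/|V_j|], and the sign restores
    [c_ij] from [|c_ij|]. *)
Lemma quotientmx_balance i j :
  Num.sg (c i j) * Num.sqrt (c i j * c j i) =
  c i j * Num.sqrt (card i) / Num.sqrt (card j).
Proof.
have i0 := card_cell_gt0 i; have j0 := card_cell_gt0 j.
have -> : c i j * c j i = c i j ^+ 2 * (card i / card j).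
  rewrite expr2 -mulrA; congr (_ * _); rewrite mulrA [c i j * _]mulrC.
  by rewrite equitable_balance mulrC mulKf // gt_eqF.
rewrite sqrtrM ?sqr_ge0 // sqrtr_sqr mulrA mulr_sg_norm -mulrA; congr (_ * _).
by rewrite sqrtrM ?sqrtrV ?ler0n.
Qed.

(** In a row of cell [V_i] both sides are [c_ij / sqrt |V_j|]: the normalization of column [i]
    cancels the factor [sqrt |V_i|] of the quotient entry. *)
Lemma characteristicmx_intertwine :
  imulmx (adjmx G) C = imulmx C (quotientmx c).
Proof.
apply/funext => v; apply/funext => j; have [i iv] := cell_cover v.
rewrite imulmx_characteristicmx (pivot_imulmx _ _ (fun k => characteristicmx_pivot iv)).
rewrite characteristicmxE mem_set // mulr1 /quotientmx quotientmx_balance.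
rewrite /adjmx -rmorph_sum /= -fsbig_finite; last exact: equitable_finite eqG j.
rewrite (equitable_sum eqG j iv) -!rmorphM /=; congr (_%:C).
by rewrite mulrA mulrCA mulVf ?mulr1 1?mulrC // sqrtr_eq0 -ltNge card_cell_gt0.
Qed.

End Characteristic.

(** * Assembly of the blocks *)

Lemma bounded_graph_row_bounded {R : realType} {V : countType} (G : wgraph R V) :
  bounded_graph G -> exists m, row_bounded (adjmx G) m.
Proof.
move=> [_ [m Gm]]; exists m => a F.
rewrite /adjmx; under eq_bigr do rewrite normc_def /= expr0n addr0 sqrtr_sqr.
rewrite -rmorph_sum /= lecR -lee_fin; apply: le_trans (Gm a).
apply: esum_ge; exists [set` F]; first by split => //; exact: finite_fset.
by rewrite fsbig_finite ?finite_fset // set_fsetK -sumEFin.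
Qed.

(** Twins share a cell, so the opposite entries of a difference column cancel against every
    indicator. *)
Lemma twin_characteristic_gram {R : realType} {V : countType} {J : choiceType}
    (G : wgraph R V) (X1 X2 : {pred V}) (f : {a : V | a \in X1} -> {a : V | a \in X2})
    (cell : J -> set V) (c : J -> J -> R) :
  equitable G cell c ->
  (forall a : {a : V | a \in X1}, exists j, cell j = [set val a; fhat f (val a)]) ->
  imulmx (itrmx (twin_diffmx f)) (characteristicmx cell) =
    (fun _ _ => 0) :> imx R[i] _ _.
Proof.
move=> eqG pair_cells; apply/funext => a; apply/funext => j.
have [i ia] := pair_cells a.
rewrite imulmx_itr_twin_diffmx !characteristicmxE.
rewrite (_ : (val a \in _) = (val (f a) \in cell j)).
  by rewrite subrr mulr0.
have ca : cell i (val a) by rewrite ia; left.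
have cfa : cell i (val (f a)) by rewrite ia fhat_val; right.
by apply/idP/idP; rewrite !inE => ja;
  [rewrite -(cell_inj eqG ca ja)|rewrite -(cell_inj eqG cfa ja)].
Qed.

Unset Implicit Arguments.

Theorem theorem3p5 (R : realType) (V : countType) (G : wgraph R V)
    (G_bounded : bounded_graph G)
    (X1 X2 : {pred V}) (f : {a : V | a \in X1} -> {a : V | a \in X2})
    (twins : edge_perturbed_twins G f)
    (J : choiceType) (cell : J -> set V) (c : J -> J -> R)
    (eqG : equitable G cell c)
    (pair_cells : forall a : {a : V | a \in X1},
       exists j, cell j = [set val a; fhat f (val a)])
    (D : imx R[i] V V) (D_sign : sign_diagonal D)
    (GD : wgraph R V)
    (adj_GD : adjmx GD = imulmx (imulmx D (adjmx G)) D) :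
  let Q := irow_mx (twin_diffmx f) (characteristicmx cell) in
  let DQ := imulmx D Q in
  let U' := transition (isubmx (adjmx (induced_subgraph G X1)) (crossmx G f)) in
  forall t : R,
    imulmx (imulmx (itrmx DQ) (transition (adjmx GD) t)) DQ =
    iblock_diag (U' t) (transition (quotientmx c) t).
Proof.
have [m A_bounded] := bounded_graph_row_bounded G_bounded.
have Q1fin := @twin_diffmx_col_finite R _ _ _ f.
have Q1sp := twin_diffmx_row_sparse twins.
have Q2fin := characteristicmx_col_finite eqG.
have Q2sp := characteristicmx_row_sparse eqG.
have gram12 := twin_characteristic_gram eqG pair_cells.
have gram21 : imulmx (itrmx (characteristicmx cell)) (twin_diffmx f) =
    (fun _ _ => 0) :> imx R[i] _ _.
  apply/funext => j; apply/funext => a.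
  transitivity (imulmx (itrmx (twin_diffmx f)) (characteristicmx cell) a j : R[i]).
    by apply: (congr1 (@isum _ V)); apply/funext => v; rewrite /itrmx mulrC.
  by rewrite gram12.
move=> Q DQ U' t.
(* The left factor [P] stays free, so each half of [Q] yields both a diagonal and an off-diagonal
   block. *)
have compress1 := transition_compression D_sign t A_bounded adj_GD _ Q1fin Q1sp
  (twin_diffmx_intertwine twins).
have compress2 := transition_compression D_sign t A_bounded adj_GD _ Q2fin Q2sp
  (characteristicmx_intertwine eqG).
(* The column index selects the half of [Q] on the right and the row index selects [P]. The Gram
   matrix is the identity when the halves agree and zero otherwise. *)
apply/funext => -[a|i]; apply/funext => -[b|j].
- have := compress1 _ _ Q1fin; rewrite (twin_diffmx_gram twins) imulmx_id_l.
  by move=> /(congr1 (fun M => M a b)).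
- have := compress2 _ _ Q1fin; rewrite gram12 imulmx_0_l.
  by move=> /(congr1 (fun M => M a j)).
- have := compress1 _ _ Q2fin; rewrite gram21 imulmx_0_l.
  by move=> /(congr1 (fun M => M i b)).
- have := compress2 _ _ Q2fin; rewrite (characteristicmx_gram eqG) imulmx_id_l.
  by move=> /(congr1 (fun M => M i j)).
Qed.
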